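(* Let $\mathbf{L}$ be a complete De Morgan Heyting algebra, $U$ a set and $R$ an $L$-relation on $U$, with upper and lower $L$-approximation operators $\mathsf{U}$ and $\mathsf{L}$. Let $\mathcal{S}$ be a finite combination (composition) of the operators $\mathsf{L}$ and $\mathsf{U}$. If $\mathsf{U}(I_x) \leq \mathcal{S}(I_x)$ for all $x \in U$, then $\mathsf{U}(A) \leq \mathcal{S}(A)$ for all $A \in \mathcal{F}_L(U)$.
   Context: A De Morgan Heyting algebra is an algebra $\mathbf{L}=(L,\vee,\wedge,\Rightarrow,{}',0,1)$ such that $(L,\vee,\wedge,\Rightarrow,0,1)$ is a Heyting algebra and $'$ satisfies $(x\wedge y)'=x'\vee y'$ and $x''=x$ for all $x,y\in L$. It is called complete if its underlying lattice is complete. An $L$-set on a set $U$ is a map $A\colon U\to L$; $\mathcal{F}_L(U)$ is the set of all $L$-sets on $U$, ordered pointwise. An $L$-relation on $U$ is a map $R\colon U\times U\to L$. Its upper and lower $L$-approximation operators $\mathsf{U},\mathsf{L}\colon\mathcal{F}_L(U)\to\mathcal{F}_L(U)$ are $\mathsf{U}(A)(x)=\bigvee_{y\in U}(R(x,y)\wedge A(y))$ and $\mathsf{L}(A)(x)=\bigwedge_{y\in U}(R(x,y)'\vee A(y))$. For $x\in U$, $I_x\in\mathcal{F}_L(U)$ is defined by $I_x(x)=1$ and $I_x(y)=0$ for $y\neq x$. A finite combination of $\mathsf{L}$ and $\mathsf{U}$ is a composition $\mathcal{O}_1\circ\cdots\circ\mathcal{O}_n$ with $n\geq 1$ and each $\mathcal{O}_i\in\{\mathsf{L},\mathsf{U}\}$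 (both taken with respect to the same $R$). *)

(* Defs.v *)
From HB Require Import structures.
From mathcomp Require Import all_boot all_order.
From mathcomp Require Import boolp classical_sets.

Set Implicit Arguments.
Unset Strict Implicit.
Unset Printing Implicit Defensive.

Import Order.TTheory.
Local Open Scope order_scope.

HB.mixin Record TBLattice_isHeyting (d : Order.disp_t) L
    of Order.TBLattice d L := {
  himp : L -> L -> L;
  le_himp : forall x y z : L, (x <= himp y z) = (x `&` y <= z)
}.

#[short(type="heytingType")]
HB.structure Definition Heyting (d : Order.disp_t) :=
  { L of TBLattice_isHeyting d L & Order.TBLattice d L }.

HB.mixin Record Heyting_isDeMorgan (d : Order.disp_t) L of Heyting d L := {
  dmneg : L -> L;
  dmnegI : forall x y : L, dmneg (x `&` y) = dmneg x `|` dmneg y;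
  dmnegK : involutive dmneg
}.

#[short(type="deMorganHeytingType")]
HB.structure Definition DeMorganHeyting (d : Order.disp_t) :=
  { L of Heyting_isDeMorgan d L & Heyting d L }.

Definition complete_lattice (d : Order.disp_t) (L : porderType d) : Prop :=
  forall A : set L, (supremums A !=set0)%classic /\ (infimums A !=set0)%classic.

(* [supremum x0 A] and [infimum x0 A] return the default [x0] when [A] is
   empty; taking [\bot] and [\top] as defaults gives the empty join and meet. *)
Definition bigjoin (d : Order.disp_t) (L : tbLatticeType d) (U : Type)
    (F : U -> L) : L := supremum \bot (range F).

Definition bigmeet (d : Order.disp_t) (L : tbLatticeType d) (U : Type)
    (F : U -> L) : L := infimum \top (range F).

Inductive approximation := Lower | Upper.

Section Approximations.
Context (d : Order.disp_t) (L : deMorganHeytingType d) (U : Type).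
Implicit Types (R : U -> U -> L) (A : U -> L).

Definition upper R A : U -> L :=
  fun x => bigjoin (fun y => R x y `&` A y).

Definition lower R A : U -> L :=
  fun x => bigmeet (fun y => dmneg (R x y) `|` A y).

Definition indicator (x : U) : U -> L :=
  fun y => if `[< y = x >] then \top else \bot.

Definition approx R (o : approximation) : (U -> L) -> (U -> L) :=
  match o with Lower => lower R | Upper => upper R end.

Definition finite_combination R (S : (U -> L) -> (U -> L)) : Prop :=
  exists2 s : seq approximation, (0 < size s)%N
    & S = foldr (fun o T => approx R o \o T) id s.

End Approximations.

Arguments indicator {d} L {U} x.

(* Main.v *)
(** For each [a : L], both operators satisfy [a /\ T(A) <= T(a /\ A)], by
    distributivity, and they are monotone; both properties pass to
    compositions.  As [A(y) /\ I_y <= A], every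
    [R(x,y) /\ A(y) = U(I_y)(x) /\ A(y) <= S(I_y)(x) /\ A(y)] is below
    [S(A)(x)]. *)
Require Import Defs.
From mathcomp Require Import all_boot all_order.
From mathcomp Require Import boolp classical_sets.

Set Implicit Arguments.
Unset Strict Implicit.
Unset Printing Implicit Defensive.

Import Order.TTheory.
Local Open Scope order_scope.

Section HeytingTheory.
Context (d : Order.disp_t) (L : heytingType d).
Implicit Types a b c : L.

(** Residuation moves [a] to the right-hand side, leaving a bound on [b]|[c] that is checked on [b]
    and [c] separately. *)
Lemma heyting_meetUr a b c : a `&` (b `|` c) <= (a `&` b) `|` (a `&` c).
Proof. by rewrite meetC -le_himp leUx !le_himp ![_ `&` a]meetC leUl leUr. Qed.

End HeytingTheory.

Section CompleteLattice.
Context (d : Order.disp_t) (L : tbLatticeType d) (U : Type).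
Hypothesis L_complete : complete_lattice L.
Implicit Types (F : U -> L) (t : L).

Lemma supremums_bigjoin F : supremums (range F) (bigjoin F).
Proof.
(* The range is empty when [U] is; the default [\bot] is then the least upper bound. Otherwise
   completeness supplies a supremum for [xget] to pick. *)
rewrite /bigjoin /supremum; case: ifP => [/eqP -> | _].
  by split=> [? []|t _]; exact: le0x.
have [[s sup_s] _] := L_complete (range F).
by case: xgetP => [_ -> //|/(_ s)].
Qed.

Lemma infimums_bigmeet F : infimums (range F) (bigmeet F).
Proof.
rewrite /bigmeet /infimum; case: ifP => [/eqP -> | _].
  by split=> [? []|t _]; exact: lex1.
have [_ [s inf_s]] := L_complete (range F).
by case: xgetP => [_ -> //|/(_ s)].
Qed.

Lemma bigjoin_ge F y : F y <= bigjoin F.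
Proof. by have [ub _] := supremums_bigjoin F; apply: ub; exists y. Qed.

Lemma bigmeet_le F y : bigmeet F <= F y.
Proof. by have [lb _] := infimums_bigmeet F; apply: lb; exists y. Qed.

Lemma bigjoin_lub F t : (forall y, F y <= t) -> bigjoin F <= t.
Proof.
move=> Ft; have [_ lub] := supremums_bigjoin F.
by apply: lub => _ [y _ <-]; exact: Ft.
Qed.

Lemma bigmeet_glb F t : (forall y, t <= F y) -> t <= bigmeet F.
Proof.
move=> tF; have [_ glb] := infimums_bigmeet F.
by apply: glb => _ [y _ <-]; exact: tF.
Qed.

End CompleteLattice.

Section Approximations.
Context (d : Order.disp_t) (L : deMorganHeytingType d) (U : Type).
Hypothesis L_complete : complete_lattice L.
Implicit Types (R : U -> U -> L) (A B : U -> L) (a : L).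

(* Monotonicity and [a /\ T(A) <= T(a /\ A)] in a single property that is
   visibly stable under composition. *)
Definition meet_monotone (T : (U -> L) -> U -> L) :=
  forall a A B, (forall y, a `&` A y <= B y) -> forall x, a `&` T A x <= T B x.

Lemma upper_meet_monotone R : meet_monotone (upper R).
Proof.
(* Residuation gives the infinite distributive law: with [a] moved across, the join is bounded term
   by term. *)
move=> a A B aAB x; rewrite meetC -le_himp.
apply: bigjoin_lub => // y; rewrite le_himp meetC meetCA.
apply: le_trans (bigjoin_ge L_complete _ y).
exact: leI2.
Qed.

Lemma lower_meet_monotone R : meet_monotone (lower R).
Proof.
move=> a A B aAB x; apply: bigmeet_glb => // y.
(* With [r] for [dmneg (R x y)]: a /\ (r \/ A(y)) <= (a /\ r) \/ (a /\ A(y)) <= r \/ B(y). *)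
apply: (le_trans (leI2 (lexx a) (bigmeet_le L_complete _ y))).
apply: (le_trans (heyting_meetUr _ _ _)).
by apply: leU2; [exact: leIr|exact: aAB].
Qed.

Lemma finite_combination_meet_monotone R S :
  finite_combination R S -> meet_monotone S.
Proof.
case=> s _ ->; elim: s => [|o s IHs] a A B aAB //= x.
(* The induction hypothesis, with the same [a], is the pointwise premise for the outermost
   operator. *)
by case: o; [apply: lower_meet_monotone|apply: upper_meet_monotone] => y;
  apply: IHs.
Qed.

Lemma upper_indicator_ge R x y : R x y <= upper R (indicator L y) x.
Proof.
apply: le_trans (bigjoin_ge L_complete _ y).
by rewrite /indicator asboolT// meetx1.
Qed.

Lemma meet_indicator_le A y z : A y `&` indicator L y z <= A z.
Proof.
by rewrite /indicator; case: asboolP => [->|_]; rewrite ?meetx1 ?meetx0 ?le0x.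
Qed.

End Approximations.

Theorem theorem3p2 (d : Order.disp_t) (L : deMorganHeytingType d)
    (L_complete : complete_lattice L)
    (U : Type) (R : U -> U -> L) (S : (U -> L) -> (U -> L))
    (S_comb : finite_combination R S) :
  (forall x : U, (upper R (indicator L x) <= S (indicator L x))%O) ->
  forall A : U -> L, (upper R A <= S A)%O.
Proof.
move=> US A; apply/lefP => x; apply: bigjoin_lub => // y; rewrite meetC.
(* [meet_monotone] for [S] is used with [a := A y] and the pair [indicator L y], [A]; the middle
   term is A(y) /\ S(I_y)(x). *)
apply: le_trans (finite_combination_meet_monotone L_complete S_comb
  (@meet_indicator_le _ _ _ A y) x).
apply: leI2 => //; apply: (le_trans (upper_indicator_ge L_complete R x y)).
by have /lefP := US y; apply.
Qed.
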